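(* Let $m\geq 2$ and $r\geq 3$ be integers. There exist a positive real $c_{m,r}$ and a positive integer $n_1$ such that for all $n\geq n_1$, $$ex_L(n,C^r_{2m})\leq c_{m,r}\, n^{1+\frac{1}{m}}.$$
   Context: An $r$-graph is an $r$-uniform hypergraph; it is linear if every two distinct edges share at most one vertex. $C^r_{k}$ ($k\geq3$) denotes the $r$-uniform linear cycle of length $k$: edges $e_1,\ldots,e_k$ with $|e_i\cap e_{i+1}|=1$ for $i\in[k-1]$, $|e_k\cap e_1|=1$, and $e_i\cap e_j=\emptyset$ for all other pairs $i\neq j$. $ex_L(n,F)$ is the maximum number of edges in a linear $r$-graph on $n$ vertices containing no copy of $F$ as a subgraph. *)

(* Defs.v *)
From mathcomp Require Import all_boot.

Set Implicit Arguments.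
Unset Strict Implicit.
Unset Printing Implicit Defensive.

Section Hypergraphs.
Variable T : finType.
Implicit Types H C : {set {set T}}.

Definition uniform (r : nat) H : bool := [forall e in H, #|e| == r].

Definition linear_hypergraph H : bool :=
  [forall e in H, forall f in H, (e != f) ==> (#|e :&: f| <= 1)].

(* [C] is a copy of the r-uniform linear cycle C^r_k.  The edges are indexed
   cyclically by 0, ..., k-1: [ordS i] is i + 1 modulo k, so the third clause
   includes the pair formed by the last and the first edge. *)
Definition linear_cycle (r k : nat) C : bool :=
  [exists e : {ffun 'I_k -> {set T}},
    [&& C == [set e i | i : 'I_k],
        uniform r C,
        [forall i, #|e i :&: e (ordS i)| == 1]
      & [forall i, forall j,
          [&& i != j, j != ordS i & i != ordS j] ==> [disjoint e i & e j]]]].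

End Hypergraphs.

(* A hypergraph up to isomorphism is represented by the predicate "being a copy
   of it" on the edge sets over an arbitrary finite vertex type. *)
Definition hypergraph_class := forall T : finType, pred {set {set T}}.

Definition free_of (F : hypergraph_class) (T : finType) (H : {set {set T}}) :
    bool :=
  ~~ [exists C : {set {set T}}, (C \subset H) && F T C].

Definition exL (n r : nat) (F : hypergraph_class) : nat :=
  \max_(H : {set {set 'I_n}} |
          [&& uniform r H, linear_hypergraph H & free_of F H]) #|H|.

(* Main.v *)
Require Import Defs.
From mathcomp Require Import all_boot all_order all_algebra.
From mathcomp Require Import reals exp.
From mathcomp Require Import zify.

(* After deleting vertices of small degree, grow a linear hypertree level by
   level from a root.  Let [X] be the last level and [M] a maximal family of
   edges, each containing one vertex of [X] and otherwise disjoint from the tree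
   and from each other.  If [M] is large it provides the next level, and [m]
   such steps would exhaust the vertices.  Otherwise a large constant times
   [#|X| + #|S|] edges join [X] to a set [S].  A random set [A] separates the
   part of these edges outside [X] from the branches of the tree, so that a path
   built from surviving edges meets the branches of its ends only in these ends.
   By linearity, linear paths can be extended greedily in a subfamily of large
   minimum degree.  Let [j] be least such that the [j]-th ancestors of any two
   vertices of [X] with a common neighbour in [S] agree.  A path of length
   [2 (m - j)] whose ends have different [(j-1)]-th ancestors is then closed by
   the tree path of length [2 j] into a linear cycle of length [2 m]. *)

Set Implicit Arguments.
Unset Strict Implicit.
Unset Printing Implicit Defensive.

(** * Linear paths and cycles *)

Section LinearPaths.
Context {T : finType}.
Implicit Types (u v w x y z : T) (e f : {set T}) (p q : seq {set T}).

Definition vcover p : {set T} := \bigcup_(e <- p) e.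

Lemma vcover_nil : vcover [::] = set0.
Proof. by rewrite /vcover big_nil. Qed.

Lemma vcover_cons e p : vcover (e :: p) = e :|: vcover p.
Proof. by rewrite /vcover big_cons. Qed.

Lemma vcover_rcons p e : vcover (rcons p e) = vcover p :|: e.
Proof. by rewrite /vcover -cats1 big_cat /= big_seq1. Qed.

Lemma vcoverP p z : reflect (exists2 e, e \in p & z \in e) (z \in vcover p).
Proof.
elim: p => [|e p IHp]; first by rewrite vcover_nil inE; constructor=> -[].
rewrite vcover_cons inE; apply: (iffP orP) => [[ze|/IHp[f fp zf]]|[f]].
- by exists e; rewrite ?mem_head.
- by exists f; rewrite // inE fp orbT.
- by rewrite inE => /orP[/eqP->|fp zf]; [left | right; apply/IHp; exists f].
Qed.

(** A linear path from [u] to [v]. Adding the joint [w] to the later edges forces [w] into [e] even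
    when [e] is the last edge; since [u != w], the equation also keeps [u] off all later edges. *)
Fixpoint lpath u p v : Prop :=
  if p is e :: p' then
    exists w, [/\ u \in e, u != w, e :&: (w |: vcover p') = [set w]
                & lpath w p' v]
  else u = v.

Lemma lpath_end u p v : lpath u p v -> v \in u |: vcover p.
Proof.
elim: p u => [|e p IHp] u /=; first by move=> ->; rewrite !inE eqxx.
case=> w [_ _ ew /IHp]; rewrite vcover_cons !inE => /orP[/eqP->|->].
  by have := set11 w; rewrite -ew inE => /andP[-> _]; rewrite orbT.
by rewrite !orbT.
Qed.

Lemma lpath_neq u e p v : lpath u (e :: p) v -> u != v.
Proof.
case=> w [ue uw ew /lpath_end vp]; apply: contraNneq uw => uv.
by rewrite -in_set1 -ew inE ue uv.
Qed.

Lemma lpath_cons u e w p v :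
  u \in e -> w \in e -> u != w -> e :&: vcover p \subset [set w] ->
  lpath w p v -> lpath u (e :: p) v.
Proof.
move=> ue we uw epw wp; exists w; split=> //; apply/setP=> z; rewrite !inE.
have [->|zw] := eqVneq z w; first by rewrite we.
apply/negP=> /andP[ze /= zp]; case/negP: zw; rewrite -in_set1.
by apply: (subsetP epw); rewrite inE ze.
Qed.

Lemma lpath_rcons u p v e w :
  lpath u p v -> e :&: (u |: vcover p) = [set v] -> w \in e -> w != v ->
  lpath u (rcons p e) w.
Proof.
move=> + + we wv; elim: p u => [|f p IHp] u /=.
  move=> -> ev; apply: (@lpath_cons _ _ w); rewrite // 1?eq_sym //.
    by have := set11 v; rewrite -ev inE => /andP[].
  by rewrite vcover_nil setI0 sub0set.
case=> w0 [uf uw0 fw0 w0p] ev.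
have w0f : w0 \in f by have := set11 w0; rewrite -fw0 inE => /andP[].
have ve : v \in e by have := set11 v; rewrite -ev inE => /andP[].
have vp := lpath_end w0p.
apply: (@lpath_cons _ _ w0) => //.
  apply/subsetP=> z; rewrite vcover_rcons !inE => /andP[zf /orP[zp|ze]].
    by rewrite -in_set1 -fw0 !inE zf zp orbT.
  have zv : z \in [set v] by rewrite -ev vcover_cons !inE ze zf orbT.
  by rewrite -in_set1 -fw0 inE zf (set1P zv) vp.
apply: IHp => //; apply/setP=> z; rewrite in_setI.
apply/andP/idP=> [[ze zp]|/set1P-> //].
rewrite -ev vcover_cons !inE ze /=; move: zp; rewrite !inE.
by case/orP=> [/eqP->|->]; rewrite ?w0f ?orbT.
Qed.

Lemma lpath_startE u p v i :
  lpath u p v -> i < size p -> (u \in nth set0 p i) = (i == 0).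
Proof.
case: p => [|e p] //= [w [ue uw ew _]]; case: i => [|i]; first by rewrite ue.
move=> /= ip; apply: contraNF uw => up; rewrite -in_set1 -ew !inE ue.
by rewrite (introT (vcoverP _ _)) ?orbT //; exists (nth set0 p i); rewrite ?mem_nth.
Qed.

Lemma lpath_endE u p v i :
  lpath u p v -> i < size p -> (v \in nth set0 p i) = (i == (size p).-1).
Proof.
elim: p u i => [|e p IHp] u i //= [w [ue uw ew wp]].
case: i => [|i] /= ip; last first.
  by rewrite (IHp w) //; case: p ip {IHp ew wp}.
case: p wp ew {IHp ip} => [->|f p wp] ew.
  by have := set11 v; rewrite -{1}ew inE => /andP[-> _].
apply: contraNF (lpath_neq wp) => ve.
by rewrite eq_sym -in_set1 -ew inE ve (lpath_end wp).
Qed.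

Lemma lpath_nthI u p v i j :
  lpath u p v -> i < j -> j < size p ->
  #|nth set0 p i :&: nth set0 p j| = (j == i.+1).
Proof.
elim: p u i j => [|e p IHp] u i [|j] //= [w [ue uw ew wp]].
case: i => [|i] /= ij jp; last by rewrite (IHp w).
have we : w \in e by have := set11 w; rewrite -ew inE => /andP[].
have := lpath_startE wp jp; rewrite eqSS => wj.
have ejw z : z \in e -> z \in nth set0 p j -> z = w.
  move=> ze zj; apply/set1P; rewrite -ew !inE ze.
  rewrite (introT (vcoverP _ _)) ?orbT //.
  by exists (nth set0 p j); rewrite ?mem_nth.
case: (j == 0) wj => wj.
  rewrite (_ : _ :&: _ = [set w]) ?cards1 //; apply/setP=> z; rewrite !inE.
  apply/andP/eqP=> [[ze zj]|-> //]; exact: ejw.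
apply/eqP; rewrite cards_eq0; apply/eqP/setP=> z; rewrite !inE.
by apply/negP=> /andP[ze zj]; move: (zj); rewrite (ejw z ze zj) wj.
Qed.

(** Edges of different paths can share only [x] or [y], and each of these lies only on the first or
    the last edge of a path. A total length above 2 keeps [x] and [y] from being shared by the same
    pair of edges. *)
Lemma lpath_catI x y p q i j :
  lpath x p y -> lpath y q x -> vcover p :&: vcover q \subset [set x; y] ->
  2 < size p + size q -> i < j -> j < size p + size q ->
  #|nth set0 (p ++ q) i :&: nth set0 (p ++ q) j| =
    (j == i.+1) || (i == 0) && (j == (size p + size q).-1).
Proof.
move=> xp yq pq gt2 ij jk; rewrite !nth_cat.
have [p0 q0] : 0 < size p /\ 0 < size q.
  case: p q xp yq gt2 {pq jk} => [|e p] [|f q] //= => [xy|+ yx].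
    by move/lpath_neq; rewrite xy eqxx.
  by move/lpath_neq; rewrite yx eqxx.
case: (ltnP j (size p)) => jp.
  by rewrite (ltn_trans ij jp) (lpath_nthI xp) //; congr nat_of_bool; lia.
case: (ltnP i (size p)) => ip; last first.
  by rewrite (lpath_nthI yq); [congr nat_of_bool; lia|lia|lia].
set j' := j - size p; have jq : j' < size q by rewrite /j'; lia.
have xi := lpath_startE xp ip; have yi := lpath_endE xp ip.
have yj := lpath_startE yq jq; have xj := lpath_endE yq jq.
have sub z : z \in nth set0 p i -> z \in nth set0 q j' -> z = x \/ z = y.
  move=> zi zj; apply/set2P/(subsetP pq); rewrite inE.
  apply/andP; split; apply/vcoverP.
    by exists (nth set0 p i); rewrite ?mem_nth.
  by exists (nth set0 q j'); rewrite ?mem_nth.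
have [/andP[i0 jl]|xN] := boolP ((i == 0) && (j' == (size q).-1)).
  rewrite (_ : _ :&: _ = [set x]).
    by rewrite cards1; move: i0 jl; rewrite /j'; lia.
  apply/setP=> z; rewrite !inE; apply/andP/eqP=> [[zi zj]|->].
    case: (sub z zi zj) => // zy; move: zi zj; rewrite zy yi yj /j'.
    by move: gt2 i0 jl; rewrite /j'; lia.
  by rewrite xi xj.
have [/andP[il j0]|yN] := boolP ((i == (size p).-1) && (j' == 0)).
  rewrite (_ : _ :&: _ = [set y]).
    by rewrite cards1; move: il j0; rewrite /j'; lia.
  apply/setP=> z; rewrite !inE; apply/andP/eqP=> [[zi zj]|->].
    case: (sub z zi zj) => // zx; move: zi zj; rewrite zx xi xj => i0 jl.
    by rewrite i0 jl in xN.
  by rewrite yi yj.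
rewrite (_ : _ :&: _ = set0) ?cards0.
  by move: xN yN; rewrite /j'; lia.
apply/setP=> z; rewrite !inE; apply/negP=> /andP[zi zj].
case: (sub z zi zj) => zE; move: zi zj; rewrite zE.
  by rewrite xi xj => i0 jl; rewrite i0 jl in xN.
by rewrite yi yj => i0 jl; rewrite i0 jl in yN.
Qed.

Lemma linear_cycle_of_lpaths (H : {set {set T}}) r k x y p q :
  uniform r H -> {subset p <= H} -> {subset q <= H} ->
  lpath x p y -> lpath y q x -> vcover p :&: vcover q \subset [set x; y] ->
  size p + size q = k -> 3 <= k ->
  exists2 C : {set {set T}}, C \subset H & linear_cycle r k C.
Proof.
move=> /forall_inP Hr pH qH xp yq pq sz k3.
pose e := [ffun i : 'I_k => nth set0 (p ++ q) i].
have eH i : e i \in H.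
  rewrite ffunE; have : nth set0 (p ++ q) i \in p ++ q.
    by rewrite mem_nth // size_cat sz.
  by rewrite mem_cat => /orP[/pH|/qH].
have eI (i j : 'I_k) : i < j ->
    #|e i :&: e j| = ((j == i.+1 :> nat) || (i == 0 :> nat) && (j == k.-1 :> nat)).
  move=> ij; rewrite !ffunE (lpath_catI xp yq pq) ?sz //.
exists [set e i | i : 'I_k]; first by apply/subsetP=> _ /imsetP[i _ ->].
apply/existsP; exists e; rewrite eqxx /=; apply/and3P; split.
- by apply/forall_inP=> _ /imsetP[i _ ->]; apply: Hr.
- apply/forallP=> i; have ik := ltn_ord i.
  have [ik1|ik1] := ltnP i.+1 k.
    by rewrite eI /= modn_small ?eqxx.
  have oi : ordS i = 0 :> nat by rewrite /= (_ : i.+1 = k) ?modnn //; lia.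
  rewrite setIC eI ?oi /=; last by lia.
  by rewrite (_ : _ || _); last lia.
- have dis (i j : 'I_k) :
      i < j -> j != ordS i -> i != ordS j -> [disjoint e i & e j].
    move=> ij ji ji'; rewrite -setI_eq0 -cards_eq0 eI // eqb0.
    apply/norP; split.
      apply: contraNneq ji => jE; apply/eqP/val_inj; rewrite /= jE modn_small //.
      by rewrite -jE.
    apply: contraNN ji' => /andP[/eqP i0 /eqP jk]; apply/eqP/val_inj => /=.
    by rewrite i0 jk prednK ?modnn //; lia.
  apply/forallP=> i; apply/forallP=> j; apply/implyP=> /and3P[ij ji ij'].
  have [lt|lt|/val_inj eq] := ltngtP i j; first exact: dis.
    by rewrite disjoint_sym; apply: dis.
  by rewrite eq eqxx in ij.
Qed.

End LinearPaths.

(** * Counting lemmas *)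

(** Vertices of positive degree below [d] are deleted one by one. Each deletion costs fewer than [d]
    members of [F], so the strict bound persists and [F] never becomes empty. *)
Lemma min_degree_subfamily (V E : finType) (inc : V -> E -> bool) (d : nat)
    (U : {set V}) (F : {set E}) :
  #|U| * d < #|F| -> (forall v e, e \in F -> inc v e -> v \in U) ->
  exists F' : {set E}, [/\ F' \subset F, F' != set0 &
    forall v e, e \in F' -> inc v e -> d <= #|[set f in F' | inc v f]|].
Proof.
have [n] := ubnP #|U|; elim: n U F => // n IHn U F Un UF FU.
pose deg v := #|[set f in F | inc v f]|.
have [v /and3P[vU v0 vd]|min] := pickP [pred v in U | (0 < deg v) && (deg v < d)].
  have Uv := cardsD1 v U; rewrite vU in Uv.
  have Fv := cardsID [set f | inc v f] F.
  rewrite (_ : F :&: _ = [set f in F | inc v f]) in Fv; last first.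
    by apply/setP=> f; rewrite !inE.
  have {}vd : #|[set f in F | inc v f]| < d by [].
  case: (IHn (U :\ v) (F :\: [set f | inc v f])) => [|||F' [sF' F'0 F'd]].
  - by lia.
  - by rewrite Uv mulnDl mul1n in UF; lia.
  - move=> w e; rewrite !inE => /andP[vNe eF] we; rewrite (FU _ _ eF we) andbT.
    by apply: contraNneq vNe => <-.
  - by exists F'; split=> //; apply: subset_trans sF' (subsetDl _ _).
exists F; split=> //; first by rewrite -card_gt0; lia.
move=> v e eF ve; have /negbT := min v; rewrite inE /= (FU v e) //=.
have -> : 0 < deg v by apply/card_gt0P; exists e; rewrite inE eF.
by rewrite /= -leqNgt.
Qed.

(** The sets [B :|: D], with [D] outside [B] and [C], are distinct for distinct [D], contain [B] and
    avoid [C]. *)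
Lemma card_separating (T : finType) (B C : {set T}) :
  [disjoint B & C] ->
  2 ^ #|T| <= 2 ^ (#|B| + #|C|) *
    #|[set A : {set T} | (B \subset A) && [disjoint C & A]]|.
Proof.
move=> BC; set Q := [set A | _].
have cBC : #|B :|: C| = #|B| + #|C| by apply/eqP; rewrite (leq_card_setU B C).
have sPQ : (setU B) @: powerset (~: (B :|: C)) \subset Q.
  apply/subsetP=> _ /imsetP[D + ->]; rewrite !inE subsetUl /= => DBC.
  rewrite -setI_eq0 setIUr setU_eq0 !setI_eq0 disjoint_sym BC /=.
  by rewrite disjoint_sym disjoints_subset (subset_trans DBC) // setCS subsetUr.
have inj : {in powerset (~: (B :|: C)) &, injective (setU B)}.
  move=> D1 D2; rewrite !powersetE => s1 s2 eqD.
  have DE (D : {set T}) : D \subset ~: (B :|: C) -> D = (B :|: D) :\: B.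
    rewrite setDUl setDv set0U => sD; apply/esym/setDidPl.
    by rewrite disjoints_subset (subset_trans sD) // setCS subsetUl.
  by rewrite (DE D1 s1) (DE D2 s2) eqD.
have := subset_leq_card sPQ; rewrite card_in_imset // card_powerset => cQ.
have <- : #|B| + #|C| + #|~: (B :|: C)| = #|T| by rewrite -cBC cardsC.
by rewrite expnD leq_mul2l cQ orbT.
Qed.

(* A uniformly random set separates each given pair with probability at least
   [2 ^- q], so some set does at least as well as the expectation. *)
Lemma exists_separating_set (T E : finType) (F : {set E}) (B C : E -> {set T})
    (q : nat) :
  (forall f, f \in F -> [disjoint B f & C f]) ->
  (forall f, f \in F -> #|B f| + #|C f| <= q) ->
  exists A : {set T},
    #|F| <= 2 ^ q * #|[set f in F | (B f \subset A) && [disjoint C f & A]]|.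
Proof.
move=> BC BCq.
pose good (A : {set T}) := #|[set f in F | (B f \subset A) && [disjoint C f & A]]|.
pose A0 := [arg max_(A > set0 : {set T}) good A].
have A0max A : good A <= good A0 by rewrite /A0; case: arg_maxnP => // i _; apply.
exists A0; rewrite -/(good A0).
have N0 : 0 < 2 ^ #|T| by rewrite expn_gt0.
rewrite -(leq_pmul2l N0).
(* Counting separated pairs from both sides computes the expectation, up to the factor
   [2 ^ #|T|]. *)
have sum_good : \sum_(A : {set T}) good A =
    \sum_(f in F) #|[set A : {set T} | (B f \subset A) && [disjoint C f & A]]|.
  pose sep f (A : {set T}) : bool := (B f \subset A) && [disjoint C f & A].
  transitivity (\sum_(A : {set T}) \sum_(f in F) (sep f A : nat)).
    apply: eq_bigr => A _; rewrite /good -sum1dep_card big_mkcondr /=.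
    by apply: eq_bigr => f _; rewrite -/(sep f A); case: (sep f A).
  rewrite exchange_big; apply: eq_bigr => f fF.
  rewrite -sum1dep_card [RHS]big_mkcond /=.
  by apply: eq_bigr => A _; rewrite -/(sep f A); case: (sep f A).
apply: (@leq_trans (2 ^ q * \sum_(A : {set T}) good A)).
  rewrite sum_good big_distrr /= mulnC -sum_nat_const.
  apply: leq_sum => f fF.
  apply: leq_trans (card_separating (BC f fF)) _.
  by rewrite leq_mul2r leq_exp2l ?BCq ?orbT.
rewrite mulnCA leq_mul2l; apply/orP; right.
have -> : 2 ^ #|T| = #|{: {set T}}|.
  by rewrite -[#|T|]cardsT -card_powerset powersetT cardsT.
by rewrite -sum_nat_const; apply: leq_sum.
Qed.

(** * Consequences of linearity *)

Lemma linear_hypergraph_eq (T : finType) (H : {set {set T}}) e f u v :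
  linear_hypergraph H -> e \in H -> f \in H -> u != v ->
  u \in e -> u \in f -> v \in e -> v \in f -> e = f.
Proof.
move=> /forall_inP linH eH fH uv ue uf ve vf; apply/eqP.
have /forall_inP/(_ f fH) := linH e eH; apply: contraTT => ef.
rewrite ef /= -ltnNge.
have <- : #|[set u; v]| = 2 by rewrite cards2 uv.
by apply/subset_leq_card/subsetP=> z /set2P[]->; rewrite inE ?ue ?ve.
Qed.

(** Send each such edge to a point where it meets [Z]. Two edges with the same image share that
    point and [v], so linearity makes the map injective. *)
Lemma card_edges_meeting (T : finType) (H : {set {set T}}) v (Z : {set T}) :
  linear_hypergraph H -> v \notin Z ->
  #|[set e in H | (v \in e) && ~~ [disjoint e & Z]]| <= #|Z|.
Proof.
move=> linH vZ; set Hv := [set e in H | _].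
pose z (e : {set T}) := odflt v [pick t in e :&: Z].
have zP e : e \in Hv -> [/\ e \in H, v \in e & z e \in e :&: Z].
  rewrite inE -setI_eq0 => /and3P[-> -> /set0Pn[t tZ]]; split=> //.
  by rewrite /z; case: pickP => //= /(_ t); rewrite tZ.
have zinj : {in Hv &, injective z}.
  move=> e f /zP[eH ve /setIP[ze zZ]] /zP[fH vf /setIP[zf _]] zef.
  apply: (linear_hypergraph_eq linH eH fH _ ve vf ze); last by rewrite zef.
  by apply: contraNneq vZ => ->.
rewrite -(card_in_imset zinj); apply/subset_leq_card/subsetP=> _ /imsetP[e eHv ->].
by have [_ _ /setIP[]] := zP e eHv.
Qed.

(** * Paths in a dense family of flags *)

Lemma card_setU_le (T : finType) (X Y : {set T}) : #|X :|: Y| <= #|X| + #|Y|.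
Proof. by rewrite cardsU leq_subr. Qed.

Lemma card_setD1_le (T : finType) (X : {set T}) z : #|X :\ z| <= #|X|.
Proof. exact/subset_leq_card/subsetDl. Qed.

Section FlagPaths.
Context {T : finType} (H : {set {set T}}) (r d : nat) (A : {set T}).
Context (F : {set T * {set T}}) (s : T * {set T} -> T).

(* A flag [(x, e)] is read as the graph edge joining [x] (outside [A]) to
   [s (x, e)] (inside [A]), labelled by the hyperedge [e]. *)
Definition flag_inc (v : T) (f : T * {set T}) := (v == f.1) || (v == s f).

Hypotheses (linH : linear_hypergraph H) (unifH : uniform r H).
Hypothesis flagF : forall f, f \in F ->
  [/\ f.2 \in H, f.1 \in f.2, f.1 \notin A, f.2 :\ f.1 \subset A
    & s f \in f.2 :\ f.1].
Hypothesis degF : forall v f, f \in F -> flag_inc v f ->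
  d <= #|[set g in F | flag_inc v g]|.

Let sP f : f \in F -> [/\ s f \in f.2, s f != f.1 & s f \in A].
Proof.
move=> fF; have [_ _ _ /subsetP fA sf] := flagF fF.
by have := fA _ sf; move: sf; rewrite !inE => /andP[-> ->].
Qed.

Let card_flag f : f \in F -> #|f.2| = r.
Proof.
by case/flagF=> fH _ _ _ _; apply/eqP; move/forall_inP: unifH; apply.
Qed.

(** The vertex [f.1] is the only one of its hyperedge outside [A]. Hence flags at a vertex can be
    counted by their hyperedges. *)
Lemma flag_fst_eq f g : f \in F -> g \in F -> f.2 = g.2 -> f = g.
Proof.
move=> fF gF fg; rewrite [f]surjective_pairing [g]surjective_pairing fg.
congr pair; have [_ ff fA _ _] := flagF fF; have [_ _ _ /subsetP gA _] := flagF gF.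
by apply: contraNeq fA => neq; apply: gA; rewrite !inE neq -fg.
Qed.

(** At least [d] distinct hyperedges of flags pass through [v], and linearity lets at most [#|Z|] of
    them meet [Z]. *)
Lemma flag_avoid v f (Z : {set T}) :
  f \in F -> flag_inc v f -> v \notin Z -> #|Z| < d ->
  exists g, [/\ g \in F, flag_inc v g & [disjoint g.2 & Z]].
Proof.
move=> fF vf vZ Zd; set Fv := [set g in F | flag_inc v g].
have [g /andP[]|meet] := pickP [pred g in Fv | [disjoint g.2 & Z]].
  by rewrite !inE => /andP[gF vg] gZ; exists g.
suff : #|Fv| <= #|Z| by rewrite leqNgt (leq_trans Zd (degF fF vf)).
apply: leq_trans (card_edges_meeting linH vZ).
have inj : {in Fv &, injective snd}.
  by move=> g h; rewrite !inE => /andP[gF _] /andP[hF _]; apply: flag_fst_eq.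
rewrite -(card_in_imset inj); apply/subset_leq_card/subsetP=> e /imsetP[g gFv ->].
have := meet g; rewrite !inE /= in gFv *; rewrite gFv => /negbT ->; rewrite andbT.
case/andP: gFv => gF vg; have [-> gg _ _ _] := flagF gF; have [sg _ _] := sP gF.
by case/orP: vg => /eqP->.
Qed.

(** The graph of flags is bipartite, with first vertices outside [A] and values of [s] inside, so a
    flag incident with [f.1] has it as its first vertex. *)
Lemma flag_avoid_fst f (Z : {set T}) :
  f \in F -> f.1 \notin Z -> #|Z| < d ->
  exists g, [/\ g \in F, g.1 = f.1 & [disjoint g.2 & Z]].
Proof.
move=> fF fZ Zd; have fi : flag_inc f.1 f by rewrite /flag_inc eqxx.
have [g [gF /orP[]/eqP fg gZ]] := flag_avoid fF fi fZ Zd; first by exists g.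
by have [_ _ /negP[]] := flagF fF; rewrite fg; have [] := sP gF.
Qed.

Lemma flag_avoid_snd f (Z : {set T}) :
  f \in F -> s f \notin Z -> #|Z| < d ->
  exists g, [/\ g \in F, s g = s f & [disjoint g.2 & Z]].
Proof.
move=> fF fZ Zd; have fi : flag_inc (s f) f by rewrite /flag_inc eqxx orbT.
have [g [gF /orP[]/eqP fg gZ]] := flag_avoid fF fi fZ Zd; last by exists g.
by have [_ _ /negP[]] := flagF gF; rewrite -fg; have [] := sP fF.
Qed.

Lemma lpath_flag_cons2 f h p y :
  f \in F -> h \in F -> s h = s f ->
  [disjoint h.2 & f.2 :\ s f] ->
  [disjoint vcover p & (f.2 :|: h.2) :\ h.1] ->
  lpath h.1 p y -> lpath f.1 (f.2 :: h.2 :: p) y.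
Proof.
move=> fF hF sfh dis disp hp.
have [_ ff _ _ _] := flagF fF; have [_ hh _ _ _] := flagF hF.
have [sff sfN _] := sP fF; have [shh shN _] := sP hF.
have hfs z : z \in h.2 -> z \in f.2 -> z = s f.
  move=> zh zf; have := disjointFr dis zh; rewrite !inE zf andbT.
  by move/negbFE/eqP.
have pfh z : z \in vcover p -> z \in f.2 :|: h.2 -> z = h.1.
  move=> zp zf; have := disjointFr disp zp; rewrite in_setD1 zf andbT.
  by move/negbFE/eqP.
apply: (@lpath_cons _ _ _ (s f)) => //; first by rewrite eq_sym.
  apply/subsetP=> z; rewrite vcover_cons !inE => /andP[zf /orP[zh|zp]].
    by rewrite (hfs z).
  have zh : z = h.1 by apply: pfh; rewrite // inE zf.
  by rewrite (hfs z) // zh.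
apply: (@lpath_cons _ _ _ h.1) => //; rewrite -?sfh //.
by apply/subsetP=> z /setIP[zh zp]; rewrite inE (pfh z) // inE zh orbT.
Qed.

(** Greedy construction, two hyperedges per round, which add at most [2 * r] vertices to the
    forbidden set. A round passes from one first vertex to another through a common neighbour, so
    the colour [c] is kept. *)
Lemma flag_walk (C : eqType) (c : T -> C) k f (Z : {set T}) :
  (forall g h, g \in F -> h \in F -> s g = s h -> c g.1 = c h.1) ->
  f \in F -> f.1 \notin Z -> #|Z| + k * (2 * r) < d ->
  exists p g, [/\ g \in F, lpath f.1 p g.1, size p = 2 * k,
    {subset p <= [set f.2 | f in F]} & [disjoint vcover p & Z] /\ c g.1 = c f.1].
Proof.
move=> cF; elim: k f Z => [|k IHk] f Z fF fZ Zd.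
  exists [::], f; split; rewrite ?vcover_nil //; split=> //.
  by rewrite -setI_eq0 set0I.
have [|g [gF gf gZ]] := flag_avoid_fst fF fZ; first by move: Zd; clear; lia.
have [_ gg _ _ _] := flagF gF; have [sgg sgN _] := sP gF.
have := card_flag gF => cg.
(* The joint is taken out of the forbidden set, since the next hyperedge must contain it. *)
have [||h [hF sh hZ]] := @flag_avoid_snd g ((Z :|: g.2) :\ s g) gF.
- by rewrite !inE eqxx.
- apply: leq_ltn_trans (card_setD1_le _ _) _.
  by apply: leq_ltn_trans (card_setU_le _ _) _; rewrite cg; move: Zd; clear; lia.
have [_ hh _ _ _] := flagF hF; have [shh shN _] := sP hF.
have := card_flag hF => ch.
have [||p [y [yF hp psz pF [pZ cy]]]] := IHk h ((Z :|: g.2 :|: h.2) :\ h.1) hF.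
- by rewrite !inE eqxx.
- have := card_setD1_le (Z :|: g.2 :|: h.2) h.1.
  have := card_setU_le (Z :|: g.2) h.2; have := card_setU_le Z g.2.
  by rewrite cg ch; move: Zd; clear; lia.
have hNZ : [disjoint h.2 & Z].
  apply/pred0P=> z /=; apply/negP=> /andP[zh zZ].
  have := disjointFr hZ zh; rewrite !inE zZ /= andbT => /negbFE/eqP zs.
  by have := disjointFr gZ sgg; rewrite -zs zZ.
exists (g.2 :: h.2 :: p), y; split=> //.
- rewrite -gf; apply: lpath_flag_cons2 => //.
    by apply: disjointWr hZ; rewrite setSD // subsetUr.
  by apply: disjointWr pZ; rewrite setSD // -setUA subsetUr.
- by rewrite /= psz mulnS.
- move=> e; rewrite !inE => /or3P[/eqP->|/eqP->|/pF //]; exact: imset_f.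
split; last by rewrite cy -gf; apply: cF.
apply/pred0P=> z /=; apply/negP=> /andP[]; rewrite !vcover_cons !inE.
case/or3P=> [zg|zh|zp] zZ; first by rewrite (disjointFr gZ zg) in zZ.
  by rewrite (disjointFr hNZ zh) in zZ.
have := disjointFr pZ zp; rewrite !inE zZ /= andbT => /negbFE/eqP zh.
by rewrite zh (disjointFr hNZ hh) in zZ.
Qed.

(* A third flag [f3] at the common neighbour of [f1] and [f2] starts a path to
   some [y] that can be prolonged backwards to both [f1.1] and [f2.1]; these
   have different colours, so one of them differs from [y]. *)
Lemma flag_bicolored_path (C C' : eqType) (c : T -> C) (c' : T -> C') l f1 f2 :
  (forall g h, g \in F -> h \in F -> s g = s h -> c g.1 = c h.1) ->
  f1 \in F -> f2 \in F -> s f1 = s f2 -> c' f1.1 != c' f2.1 ->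
  (l.+1 * 2 + 2) * r < d ->
  exists p f g, [/\ f \in F, g \in F, lpath f.1 p g.1, size p = 2 * l.+1
    & [/\ {subset p <= [set f.2 | f in F]}, c f.1 = c g.1 & c' f.1 != c' g.1]].
Proof.
move=> cF f1F f2F sf12 c'12 dlt.
have := card_flag f1F => c1; have := card_flag f2F => c2.
have [||f3 [f3F sf3 f3Z]] := @flag_avoid_snd f1 ((f1.2 :|: f2.2) :\ s f1) f1F.
- by rewrite !inE eqxx.
- apply: leq_ltn_trans (card_setD1_le _ _) _.
  apply: leq_ltn_trans (card_setU_le _ _) _; rewrite c1 c2.
  by move: dlt; clear; nia.
have := card_flag f3F => c3.
(* Both candidate first edges are avoided, as the one to use is known only once [y] is. *)
have [||p [y [yF f3p psz pF [pZ cy]]]] :=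
    @flag_walk C c l f3 ((f1.2 :|: f2.2 :|: f3.2) :\ f3.1) cF f3F.
- by rewrite !inE eqxx.
- have := card_setD1_le (f1.2 :|: f2.2 :|: f3.2) f3.1.
  have := card_setU_le (f1.2 :|: f2.2) f3.2; have := card_setU_le f1.2 f2.2.
  by rewrite c1 c2 c3; move: dlt; clear; nia.
have [f [fF sf sf12' c'f]] : exists f, [/\ f \in F, s f = s f1,
    f.2 \subset f1.2 :|: f2.2 & c' f.1 != c' y.1].
  have [c'1|c'1] := eqVneq (c' f1.1) (c' y.1).
    by exists f2; rewrite subsetUr -c'1 eq_sym.
  by exists f1; rewrite subsetUl.
exists (f.2 :: f3.2 :: p), f, y; split=> //; last first.
- split=> //; last by rewrite cy; apply: cF; rewrite // sf.
  move=> e; rewrite !inE => /or3P[/eqP->|/eqP->|/pF //]; exact: imset_f.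
- by rewrite /= psz mulnS.
apply: lpath_flag_cons2 => //; first by rewrite sf.
  by apply: disjointWr f3Z; rewrite sf setSD.
by apply: disjointWr pZ; rewrite setSD // setSU.
Qed.

End FlagPaths.

(** * Linear hypertrees *)

(* The last level [X] of a linear hypertree of depth [i] in [H] with vertex set
   [W]: [anc j x] is the [j]-th ancestor of [x], and [P x] consists of the
   vertices of the branch joining [x] to the root. *)
Record tree_level (T : finType) (H : {set {set T}}) (r i : nat) (X W : {set T})
    (anc : nat -> T -> T) (P : T -> {set T}) : Prop := TreeLevel {
  anc0 : forall x, x \in X -> anc 0 x = x;
  anc_root : forall x y, x \in X -> y \in X -> anc i x = anc i y;
  branch_mem : forall x, x \in X -> x \in P x;
  branch_sub : forall x, x \in X -> P x \subset W;
  branch_level : forall x, x \in X -> P x :&: X \subset [set x];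
  card_branch : forall x, x \in X -> #|P x| <= (r * i).+1;
  tree_lpath : forall j x y, j < i -> x \in X -> y \in X ->
    anc j.+1 x = anc j.+1 y -> anc j x != anc j y ->
    exists p, [/\ lpath x p y, size p = 2 * j.+1, {subset p <= H}
                & vcover p \subset P x :|: P y] }.

Lemma tree_level_root (T : finType) (H : {set {set T}}) r (x0 : T) :
  tree_level H r 0 [set x0] [set x0] (fun=> id) (fun x => [set x]).
Proof.
split=> // [x y /set1P-> /set1P-> //|x|x|x _|x _]; rewrite ?set11 //.
- by move/set1P->.
- exact: subsetIl.
- by rewrite cards1.
Qed.

Lemma card_flag_edges (T : finType) (H : {set {set T}}) r (M : {set T * {set T}}) :
  uniform r H -> (forall f, f \in M -> f.2 \in H) ->
  #|\bigcup_(f in M) f.2| <= #|M| * r.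
Proof.
move=> /forall_inP unifH MH.
rewrite -sum_nat_const; elim/big_ind2: _ => [|a A b B ha hb|f fM].
- by rewrite cards0.
- by apply: leq_trans (card_setU_le _ _) _; rewrite leq_add.
- by rewrite (eqP (unifH _ (MH f fM))).
Qed.

(** * Adding a level to the hypertree *)

Section Grow.
Context {T : finType} (H : {set {set T}}) (r i : nat) (X W : {set T}).
Context (anc : nat -> T -> T) (P : T -> {set T}) (M : {set T * {set T}}).
Hypotheses (unifH : uniform r H) (r_gt1 : 1 < r).
Hypothesis tX : tree_level H r i X W anc P.
Hypothesis flagM : forall f, f \in M ->
  [/\ f.1 \in X, f.2 \in H, f.1 \in f.2 & [disjoint f.2 :\ f.1 & W]].
Hypothesis disM : forall f g, f \in M -> g \in M -> f != g ->
  [disjoint f.2 :\ f.1 & g.2 :\ g.1].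

(** One vertex of each edge of [M] goes to the new level. The default is not reached, since edges
    have at least two vertices; [back] inverts [child] on [M]. *)
Let child (f : T * {set T}) := odflt f.1 [pick y in f.2 :\ f.1].
Let back (y : T) := odflt (y, set0) [pick f in M | child f == y].

Let card_edge f : f \in M -> #|f.2| = r.
Proof. by case/flagM=> _ fH _ _; apply/eqP; move/forall_inP: unifH; apply. Qed.

Let childP f : f \in M -> child f \in f.2 :\ f.1.
Proof.
move=> fM; rewrite /child; case: pickP => //= none.
have [_ _ ff _] := flagM fM; have := cardsD1 f.1 f.2.
by rewrite ff (card_edge fM) eq_card0 //; move: r_gt1 => + rE; rewrite rE.
Qed.

Let same_flag f g z : f \in M -> g \in M ->
  z \in f.2 :\ f.1 -> z \in g.2 :\ g.1 -> f = g.
Proof.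
move=> fM gM zf zg; apply/eqP/negP=> /negP neq.
by have := disjointFr (disM fM gM neq) zf; rewrite zg.
Qed.

Let child_inj : {in M &, injective child}.
Proof.
move=> f g fM gM fg; apply: (same_flag (z := child f)) => //.
  exact: childP.
by rewrite fg; apply: childP.
Qed.

Let backK f : f \in M -> back (child f) = f.
Proof.
move=> fM; rewrite /back; case: pickP => [g /andP[gM /eqP]|/(_ f)] /=.
  exact: child_inj.
by rewrite fM eqxx.
Qed.

Let X' := child @: M.
Let W' := W :|: \bigcup_(f in M) f.2.
Let anc' j y := if j is j'.+1 then anc j' (back y).1 else y.
Let P' y := (back y).2 :|: P (back y).1.

Let mem_tree f z : f \in M -> z \in W -> z \in f.2 -> z = f.1.
Proof.
move=> fM zW zf; have [_ _ _ dis] := flagM fM.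
by have := disjointFl dis zW; rewrite !inE zf andbT => /negbFE/eqP.
Qed.

(** Two new vertices are joined by the old path between their parents with one new edge at each end.
    The new edges meet the old tree only in the parents, so the path stays linear. *)
Lemma tree_level_grow :
  exists X' W' anc' P', [/\ tree_level H r i.+1 X' W' anc' P',
    #|X'| = #|M|, #|W'| <= #|W| + #|M| * r & X' \subset cover H].
Proof.
exists X', W', anc', P'; split; last 1 first.
- apply/subsetP=> _ /imsetP[f fM ->]; apply/bigcupP; exists f.2.
    by have [] := flagM fM.
  by have := childP fM; rewrite inE => /andP[].
- split=> //.
  + move=> _ _ /imsetP[f fM ->] /imsetP[g gM ->] /=; rewrite !backK //.
    have [fX _ _ _] := flagM fM; have [gX _ _ _] := flagM gM.
    exact: (anc_root tX).
  + move=> _ /imsetP[f fM ->]; rewrite /P' backK // inE.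
    by have := childP fM; rewrite inE => /andP[_ ->].
  + move=> _ /imsetP[f fM ->]; rewrite /P' /W' backK // setUC setUSS //.
      by have [fX _ _ _] := flagM fM; apply: (branch_sub tX).
    exact: (bigcup_sup f).
  + move=> _ /imsetP[f fM ->]; apply/subsetP=> z /setIP[gP /imsetP[g gM zg]].
    move: gP; rewrite {}zg {z} /P' backK // in_setU => gP.
    have gWN : child g \notin W.
      by have [_ _ _ dis] := flagM gM; rewrite (disjointFr dis) // childP.
    have [fX _ _ _] := flagM fM.
    case/orP: gP => [gf|/(subsetP (branch_sub tX fX))]; last by rewrite (negbTE gWN).
    suff -> : g = f by apply: set11.
    apply: (same_flag (z := child g)) => //; first exact: childP.
    rewrite !inE gf andbT; apply: contraNneq gWN => ->.
    exact/(subsetP (branch_sub tX fX))/(branch_mem tX).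
  + move=> _ /imsetP[f fM ->]; rewrite /P' backK //.
    have [fX _ _ _] := flagM fM.
    rewrite mulnS -addnS; apply: leq_trans (card_setU_le _ _) _.
    by rewrite leq_add ?card_edge // (card_branch tX).
  + move=> j _ _ ji /imsetP[f fM ->] /imsetP[g gM ->].
    rewrite /= !backK // => eqj neqj.
    have [fX fH ff _] := flagM fM; have [gX gH gg gW] := flagM gM.
    have fg : f != g by apply: contraNneq neqj => ->.
    have [p [fpg psz pH pP]] : exists p, [/\ lpath f.1 p g.1, size p = 2 * j,
        {subset p <= H} & vcover p \subset P f.1 :|: P g.1].
      (* At [j = 0] the two parents coincide, and the path between them is empty. *)
      case: j ji eqj neqj => [|j] ji; first last.
        by rewrite /= !backK // => eqj neqj; apply: (tree_lpath tX).
      rewrite !(anc0 tX) // => eq0 _; exists [::].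
      by split; rewrite ?vcover_nil ?sub0set.
    have pW : vcover p \subset W.
      by apply: subset_trans pP _; rewrite subUset !(branch_sub tX).
    have fWX : f.1 \in W by apply/(subsetP (branch_sub tX fX))/(branch_mem tX).
    have gWX : g.1 \in W by apply/(subsetP (branch_sub tX gX))/(branch_mem tX).
    have /setD1P[cfN cf] := childP fM; have /setD1P[cgN cg] := childP gM.
    have fp : lpath (child f) (f.2 :: p) g.1.
      apply: (@lpath_cons _ _ _ f.1) => //; apply/subsetP=> z /setIP[zf zp].
      by rewrite inE; apply/eqP/(mem_tree fM) => //; apply: (subsetP pW).
    exists (rcons (f.2 :: p) g.2); split.
    * apply: (lpath_rcons fp) => //; apply/setP=> z; rewrite in_setI in_set1.
      apply/andP/eqP=> [[zg]|->]; last by rewrite (lpath_end fp).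
      rewrite vcover_cons in_setU1 in_setU => zfp.
      have {zfp}/orP[zf|zp] : (z \in f.2) || (z \in vcover p).
        by case/or3P: zfp => [/eqP->|->|->]; rewrite ?cf ?orbT.
        have [zf1|zf1] := eqVneq z f.1.
          by apply: (mem_tree gM); rewrite // zf1.
        apply/eqP/negP=> /negP zg1; case/negP: fg; apply/eqP.
        by apply: (same_flag (z := z)); rewrite // !inE ?zf1 ?zg1.
      by apply: (mem_tree gM) => //; apply: (subsetP pW).
    * by rewrite size_rcons /= psz mulnS.
    * move=> e; rewrite mem_rcons !inE => /or3P[/eqP->|/eqP->|/pH] //.
    * rewrite vcover_rcons vcover_cons /P' !backK // -!setUA setUS //.
      rewrite setUC subUset; apply/andP; split.
        by apply/subsetP=> z zg; rewrite !inE zg !orbT.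
      apply: subset_trans pP _; apply/subsetP=> z; rewrite !inE.
      by case/orP=> ->; rewrite ?orbT.
- exact: card_in_imset.
- apply: leq_trans (card_setU_le _ _) _; rewrite leq_add2l.
  by apply: (card_flag_edges unifH) => f /flagM[].
Qed.

End Grow.

(** The factor [2 ^ (r * m)] pays for the separation by [A], and [((2 * m + 2) * r).+1] is the
    minimum degree that the greedy paths need. *)
Lemma tree_level_dense (T : finType) (H : {set {set T}}) (r m i : nat)
    (X W S : {set T}) anc P (F : {set T * {set T}}) :
  linear_hypergraph H -> uniform r H -> tree_level H r i X W anc P ->
  i < m ->
  (forall f, f \in F -> [/\ f.1 \in X, f.2 \in H, f.1 \in f.2,
     [disjoint f.2 :\ f.1 & P f.1] & ~~ [disjoint f.2 :\ f.1 & S]]) ->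
  2 ^ (r * m) * ((#|X| + #|S|) * ((2 * m + 2) * r).+1) < #|F| ->
  exists2 C : {set {set T}}, C \subset H & linear_cycle r (2 * m) C.
Proof.
move=> linH unifH tX im flagF; set d := ((2 * m + 2) * r).+1 => Fbig.
have card_edge e : e \in H -> #|e| = r.
  by move=> eH; apply/eqP; move/forall_inP: unifH; apply.
pose s (f : T * {set T}) := odflt f.1 [pick t in (f.2 :\ f.1) :&: S].
have sP f : f \in F -> s f \in (f.2 :\ f.1) :&: S.
  case/flagF=> _ _ _ _; rewrite /s -setI_eq0 => /set0Pn[t tfS].
  by case: pickP => //= /(_ t); rewrite tfS.
have [||A FA] := @exists_separating_set T _ F (fun f => f.2 :\ f.1)
                   (fun f => P f.1) (r * m).
- by move=> f /flagF[].
- move=> f /flagF[fX fH ff _ _]; have := cardsD1 f.1 f.2.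
  have := card_branch tX fX; rewrite ff (card_edge _ fH) => PX cf.
  (* The edge contributes [r - 1] vertices besides [f.1], and the branch at most [r * i + 1]. *)
  apply: (@leq_trans (r * i.+1)); last by rewrite leq_mul2l im orbT.
  by move: PX cf; rewrite mulnS; clear; lia.
set F1 := [set f in F | _] in FA.
have F1F f : f \in F1 -> f \in F by rewrite inE => /andP[].
have [||F2 [sF2 F20 degF2]] :=
    @min_degree_subfamily T _ (flag_inc s) d (X :|: S) F1.
- have {}FA := leq_trans Fbig FA; rewrite ltn_pmul2l ?expn_gt0 // in FA.
  by apply: (leq_ltn_trans _ FA); rewrite leq_mul2r card_setU_le orbT.
- move=> v f /F1F fF /orP[]/eqP->; rewrite inE.
    by have [-> ] := flagF f fF.
  by have := sP f fF; rewrite in_setI => /andP[_ ->]; rewrite orbT.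
have F2F f : f \in F2 -> f \in F by move=> /(subsetP sF2)/F1F.
have PA f : f \in F2 -> [disjoint P f.1 & A].
  by move=> /(subsetP sF2); rewrite inE => /and3P[].
have flagF2 f : f \in F2 -> [/\ f.2 \in H, f.1 \in f.2, f.1 \notin A,
    f.2 :\ f.1 \subset A & s f \in f.2 :\ f.1].
  move=> fF2; have [fX fH ff _ _] := flagF f (F2F f fF2).
  have := sP f (F2F f fF2); rewrite in_setI => /andP[-> _].
  have := subsetP sF2 f fF2; rewrite inE => /and3P[_ -> _].
  by rewrite (disjointFr (PA f fF2)) ?(branch_mem tX).
(* Some two flags with a common neighbour have different [j]-th ancestors. This holds at 0 by the
   minimum degree and fails at [i], where every ancestor is the root. *)
pose split j :=
  [exists f in F2, exists g in F2, (s f == s g) && (anc j f.1 != anc j g.1)].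
have split0 : split 0.
  case/set0Pn: F20 => f fF2; have [fH ff _ _ sf] := flagF2 f fF2.
  have [||g [gF2 sg gf]] := @flag_avoid_snd T H d A F2 s linH flagF2 degF2 f
                              (f.2 :\ s f) fF2.
  - by rewrite !inE eqxx.
  - apply: leq_ltn_trans (card_setD1_le _ _) _.
    by rewrite (card_edge _ fH) /d; clear; nia.
  apply/exists_inP; exists f => //; apply/exists_inP; exists g => //.
  have [fX _ _ _ _] := flagF f (F2F f fF2); have [gX _ _ _ _] := flagF g (F2F g gF2).
  rewrite sg eqxx /= !(anc0 tX) //; have [_ gg _ _ _] := flagF2 g gF2.
  apply: contraFneq (disjointFr gf gg) => <-.
  by rewrite !inE ff andbT eq_sym; move: sf; rewrite !inE => /andP[].
have spliti : ~~ split i.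
  apply/negP=> /exists_inP[f fF2 /exists_inP[g gF2 /andP[_ /negP[]]]].
  have [fX _ _ _ _] := flagF f (F2F f fF2); have [gX _ _ _ _] := flagF g (F2F g gF2).
  by rewrite (anc_root tX fX gX).
have [[|j] Nsplit jmin] := @ex_minnP (fun j => ~~ split j) (ex_intro _ i spliti).
  by rewrite split0 in Nsplit.
have ji : j < i by apply: jmin.
have splitj : split j by apply: contraT => /jmin; rewrite ltnn.
have /exists_inP[f1 f1F /exists_inP[f2 f2F /andP[/eqP s12 c12]]] := splitj.
have cF g h : g \in F2 -> h \in F2 -> s g = s h -> anc j.+1 g.1 = anc j.+1 h.1.
  move=> gF2 hF2 sgh; apply: contraNeq Nsplit => neq.
  apply/exists_inP; exists g => //; apply/exists_inP; exists h => //.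
  by rewrite sgh eqxx.
(* The flag path will have length [2 * l.+1] and the tree path [2 * j.+1]; [j < i < m] leaves room
   for the former. *)
have [l lE] : exists l, m = l.+1 + j.+1.
  by exists (m - j.+2); move: ji im; clear; lia.
have [|p [f [g [fF2 gF2 fpg psz [pF cfg c'fg]]]]] :=
    @flag_bicolored_path T H r d A F2 s linH unifH flagF2 degF2 _ _
      (anc j.+1) (anc j) l f1 f2 cF f1F f2F s12 c12.
  by rewrite /d lE; clear; nia.
have [fX _ _ _ _] := flagF f (F2F f fF2); have [gX _ _ _ _] := flagF g (F2F g gF2).
have [||q [gqf qsz qH qP]] := @tree_lpath _ _ _ _ _ _ _ _ tX j g.1 f.1 ji gX fX.
- by rewrite cfg.
- by rewrite eq_sym.
apply: (linear_cycle_of_lpaths unifH _ qH fpg gqf).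
- by move=> e /pF /imsetP[h hF2 ->]; have [] := flagF2 h hF2.
(* A vertex of the tree path lies on a branch, hence outside [A]. On the flag path such a vertex is
   the first vertex of a flag, so it is in [X], where a branch contains only its own end. *)
- apply/subsetP=> z /setIP[/vcoverP[e /pF/imsetP[h hF2 ->] zh] zq].
  have [hX _ _ _ _] := flagF h (F2F h hF2); have [_ _ _ hA _] := flagF2 h hF2.
  have zP : (z \in P g.1) || (z \in P f.1).
    by have := subsetP qP z zq; rewrite inE.
  have zA : z \notin A.
    by case/orP: zP => zP; rewrite (disjointFr (PA _ _) zP).
  have zE : z = h.1.
    apply/eqP; apply: contraNT zA => zN; apply: (subsetP hA).
    by rewrite !inE zN.
  have zX : z \in X by rewrite zE.
  rewrite !inE; case/orP: zP => zP.
    have := subsetP (branch_level tX gX) z; rewrite !inE zP zX => -> //.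
    by rewrite orbT.
  by have := subsetP (branch_level tX fX) z; rewrite !inE zP zX => ->.
- by rewrite psz qsz lE; clear; lia.
- by rewrite lE; clear; lia.
Qed.

(** * The bound *)

Definition density_const (m r : nat) := 2 ^ (r * m) * ((2 * m + 2) * r).+1.

(** The term [r * m] covers edges that meet the branch of their vertex again; [1 + 2 * r + q * r]
    bounds the ratio of [#|X| + #|S|] to [#|X|]. Growth linear in [q] is what yields the exponent
    [1 + 1/m]. *)
Definition degree_bound (m r q : nat) :=
  (r * m + density_const m r * (1 + 2 * r + q * r)).+1.

(** * The growing tree under a minimum degree condition *)

Section MinDegree.
Context {T : finType} (H : {set {set T}}) (r m q : nat).
Hypotheses (linH : linear_hypergraph H) (unifH : uniform r H).
Hypotheses (r_gt1 : 1 < r) (q_gt1 : 1 < q).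
Hypothesis degH : forall v e, e \in H -> v \in e ->
  degree_bound m r q <= #|[set f in H | v \in f]|.
Hypothesis acyclicH : forall C : {set {set T}},
  C \subset H -> ~~ linear_cycle r (2 * m) C.

(** By linearity, at most [r * i] edges through [x] meet the branch of [x] in another vertex. *)
Lemma card_branch_flags i (X W : {set T}) anc P :
  tree_level H r i X W anc P -> i < m -> X \subset cover H ->
  #|X| * (density_const m r * (1 + 2 * r + q * r)).+1 <=
    #|[set f : T * {set T} | [&& f.1 \in X, f.2 \in H, f.1 \in f.2
                             & [disjoint f.2 :\ f.1 & P f.1]]]|.
Proof.
move=> tX im sXH.
pose Q x e := [&& e \in H, x \in e & [disjoint e :\ x & P x]].
have -> : #|[set f : T * {set T} | [&& f.1 \in X, f.2 \in H, f.1 \in f.2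
      & [disjoint f.2 :\ f.1 & P f.1]]]| = \sum_(x in X) #|[set e | Q x e]|.
  rewrite -sum1dep_card.
  transitivity (\sum_(x in X) \sum_(e | Q x e) 1).
    by rewrite pair_big_dep /=; apply: eq_bigl => -[x e].
  by apply: eq_bigr => x _; rewrite sum1dep_card.
rewrite -sum_nat_const; apply: leq_sum => x xX.
have /bigcupP[e eH xe] := subsetP sXH x xX.
have := degH eH xe; rewrite /degree_bound -addnS.
have xP : x \notin P x :\ x by rewrite !inE eqxx.
have bad := card_edges_meeting linH xP.
have := card_branch tX xX; rewrite (cardsD1 x) (branch_mem tX) // add1n ltnS => Pri.
have {}Pri := leq_trans bad (leq_trans Pri (leq_mul (leqnn r) (ltnW im))).
have sub : [set f in H | x \in f] \subset [set e | Q x e] :|: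
    [set e in H | (x \in e) && ~~ [disjoint e & P x :\ x]].
  apply/subsetP=> f; rewrite !inE /Q => /andP[-> ->] /=.
  by rewrite -!setI_eq0 setIDA setIDAC orbN.
have := leq_trans (subset_leq_card sub) (card_setU_le _ _).
by move: Pri; clear; lia.
Qed.

(** The invariant [#|W| <= 2 * r * #|X|] bounds [S] by a multiple of [#|X|] when [M] is small, so
    that the dense case applies. *)
Lemma tree_level_step i (X W : {set T}) anc P :
  tree_level H r i X W anc P -> i < m -> X \subset cover H -> 0 < #|X| ->
  #|W| <= 2 * r * #|X| ->
  exists X' W' anc' P', [/\ tree_level H r i.+1 X' W' anc' P',
    X' \subset cover H, q * #|X| <= #|X'| & #|W'| <= 2 * r * #|X'|].
Proof.
move=> tX im sXH X0 WX; have := card_branch_flags tX im sXH.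
set F := [set f : T * {set T} | _] => Fbig.
pose ok (M : {set T * {set T}}) := (M \subset F) &&
  [forall f in M, [disjoint f.2 :\ f.1 & W] &&
    [forall g in M, (f != g) ==> [disjoint f.2 :\ f.1 & g.2 :\ g.1]]].
have ok0 : ok set0.
  by rewrite /ok sub0set; apply/forall_inP=> f; rewrite inE.
case: (@arg_maxnP _ set0 ok (fun M => #|M|) ok0) => M okM Mmax.
case/andP: (okM) => /subsetP sMF /forall_inP disM.
pose S := W :|: \bigcup_(f in M) f.2.
have MH f : f \in M -> f.2 \in H by move/sMF; rewrite inE => /and4P[].
(* By maximality: a flag whose other vertices avoid [S] could be added to [M]. *)
have meetS f : f \in F -> ~~ [disjoint f.2 :\ f.1 & S].
  move=> fF; apply/negP=> fS; have := fF; rewrite inE => /and4P[_ fH ff _].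
  have fW : [disjoint f.2 :\ f.1 & W] by apply: disjointWr fS; apply: subsetUl.
  have fM g : g \in M -> [disjoint f.2 :\ f.1 & g.2 :\ g.1].
    move=> gM; apply: disjointWr fS; apply: subset_trans (subsetDl _ _) _.
    by apply: subset_trans (subsetUr _ _); apply: (bigcup_sup g).
  have fNM : f \notin M.
    apply/negP=> /fM; rewrite -setI_eq0 setIid -cards_eq0 => /eqP f0.
    have := cardsD1 f.1 f.2; rewrite ff f0 addn0 => f1; move: r_gt1.
    by move/forall_inP: unifH => /(_ _ fH)/eqP; rewrite f1 => <-.
  suff /Mmax /= : ok (f |: M) by rewrite cardsU1 fNM /= ltnn.
  apply/andP; split; first by rewrite subUset sub1set fF; case/andP: okM.
  apply/forall_inP=> g /setU1P[->|gM].
    rewrite fW /=; apply/forall_inP=> h /setU1P[->|hM]; rewrite ?eqxx //.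
    by rewrite fM // implybT.
  have /andP[-> /forall_inP gdis] := disM g gM.
  apply/forall_inP=> h /setU1P[->|hM]; last exact: gdis.
  by rewrite disjoint_sym fM // implybT.
have [qM|Mq] := leqP (q * #|X|) #|M|.
  have [|f g fM gM fg|X' [W' [anc' [P' [tX' cX' cW' sX'H]]]]] :=
      @tree_level_grow T H r i X W anc P M unifH r_gt1 tX.
  - move=> f fM; have := sMF f fM; rewrite inE => /and4P[-> -> -> _].
    by have /andP[] := disM f fM.
  - have /andP[_ /forall_inP/(_ g gM)] := disM f fM.
    by rewrite fg.
  exists X', W', anc', P'; split; rewrite ?cX' //.
  apply: leq_trans cW' _; apply: leq_trans (leq_add WX (leqnn _)) _.
  (* As [q] is at least 2, [#|W|] is at most [r * #|M|], and the new edges add at most as much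
     again. *)
  have : 2 * #|X| <= #|M| by apply: leq_trans qM; rewrite leq_mul2r q_gt1 orbT.
  by clear; nia.
have S_le : #|S| <= #|X| * (2 * r + q * r).
  apply: leq_trans (card_setU_le _ _) _.
  have := card_flag_edges unifH MH; move: WX Mq; clear.
  by move: #|\bigcup_(_ in _) _| => b; nia.
have [||C sCH cycC] := @tree_level_dense T H r m i X W S anc P F linH unifH tX im.
- move=> f fF; split; rewrite ?meetS //; move: fF; rewrite inE; by case/and4P.
- apply: leq_trans Fbig.
  have XS : #|X| + #|S| <= #|X| * (1 + 2 * r + q * r).
    by rewrite -addnA mulnDr muln1 leq_add2l.
  have XSd := leq_mul (leqnn (2 ^ (r * m)))
    (leq_mul XS (leqnn ((2 * m + 2) * r).+1)).
  apply: leq_ltn_trans XSd _; rewrite /density_const; move: X0; clear.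
  by move: (2 ^ _) ((2 * m + 2) * r).+1 (1 + 2 * r + q * r) => a b c; nia.
- by have := acyclicH sCH; rewrite cycC.
Qed.

(** Each of the [m] levels above the root multiplies the size of the last level by at least [q]. *)
Lemma min_degree_card : H != set0 -> q ^ m <= #|T|.
Proof.
case/set0Pn=> e eH.
have /set0Pn[x xe] : e != set0.
  rewrite -card_gt0; move/forall_inP: unifH => /(_ e eH)/eqP->.
  exact: ltnW.
have tree i : i <= m -> exists X W anc P, [/\ tree_level H r i X W anc P,
    X \subset cover H, q ^ i <= #|X| & #|W| <= 2 * r * #|X|].
  elim: i => [_|i IHi im].
    exists [set x], [set x], (fun=> id), (fun x => [set x]).
    split; rewrite ?cards1 //; last by move: r_gt1; clear; lia.
      exact: tree_level_root.
    by rewrite sub1set; apply/bigcupP; exists e.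
  have [X [W [anc [P [tX sXH qX WX]]]]] := IHi (ltnW im).
  have X0 : 0 < #|X|.
    by apply: leq_trans qX; rewrite expn_gt0 (ltnW q_gt1).
  have [X' [W' [anc' [P' [tX' sX'H qX' WX']]]]] := tree_level_step tX im sXH X0 WX.
  exists X', W', anc', P'; split=> //; apply: leq_trans qX'.
  by rewrite expnS leq_mul2l qX orbT.
have [X [W [anc [P [_ _ qX _]]]]] := tree m (leqnn m).
exact: leq_trans qX (max_card _).
Qed.

End MinDegree.

(** More edges would leave a nonempty subfamily of minimum degree [degree_bound m r q], whose tree
    would need [q ^ m] vertices. *)
Lemma card_linear_cycle_free (T : finType) (H : {set {set T}}) (r m q : nat) :
  1 < r -> 1 < q -> #|T| < q ^ m ->
  uniform r H -> linear_hypergraph H ->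
  free_of (fun T => @linear_cycle T r (2 * m)) H ->
  #|H| <= #|T| * degree_bound m r q.
Proof.
move=> r1 q1 Tq unifH linH freeH; rewrite leqNgt; apply/negP=> Hbig.
have [||H' [sH' H'0 degH']] :=
    @min_degree_subfamily T _ (fun v (e : {set T}) => v \in e)
      (degree_bound m r q) setT H.
- by rewrite cardsT.
- by move=> v e _ _; rewrite inE.
suff : q ^ m <= #|T| by rewrite leqNgt Tq.
apply: (@min_degree_card T H' r m q) => //.
- apply/forall_inP=> e /(subsetP sH') eH; apply/forall_inP=> f /(subsetP sH') fH.
  by move/forall_inP: linH => /(_ e eH)/forall_inP/(_ f fH).
- by apply/forall_inP=> e /(subsetP sH') eH; move/forall_inP: unifH; apply.
- move=> C sC; apply: contraNN freeH => cycC; apply/existsP; exists C.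
  by rewrite (subset_trans sC sH').
Qed.

(** The least [q] with [n < q ^ m] is one more than the integer part of the [m]-th root of [n]. *)
Lemma exists_nat_root (m n : nat) : (0 < m)%N -> (0 < n)%N ->
  exists q, [/\ 1 < q, n < q ^ m & q.-1 ^ m <= n]%N.
Proof.
move=> m0 n0; have ex : exists q, n < q ^ m.
  exists n.+1; apply: (@leq_trans (n.+1 ^ 1)); first by rewrite expn1.
  by rewrite leq_exp2l.
case: (ex_minnP ex) => q nq qmin; exists q; split=> //.
  case: q nq {qmin} => [|[|//]]; first by rewrite exp0n.
  by rewrite exp1n ltnNge n0.
case: q nq qmin => [|q] nq qmin; first by rewrite exp0n.
by rewrite leqNgt; apply/negP=> /qmin; rewrite ltnn.
Qed.

Lemma degree_bound_le (m r q : nat) : 0 < q ->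
  degree_bound m r q <= degree_bound m r 1 * q.
Proof.
rewrite /degree_bound; move: (density_const m r) => D q0.
suff : 1 + 2 * r + q * r <= (1 + 2 * r + 1 * r) * q.
  move=> /(leq_mul (leqnn D)); move: (1 + _ + _) => a; nia.
by nia.
Qed.

(** * The estimate with real exponents *)

Local Open Scope ring_scope.
Import Order.TTheory GRing.Theory Num.Theory.

Lemma ler_powR_root (R : realType) (m a n : nat) : (0 < m)%N ->
  (a ^ m <= n)%N -> a%:R <= n%:R `^ m%:R^-1 :> R.
Proof.
move=> m0 an.
have -> : a%:R = (a ^ m)%:R `^ m%:R^-1 :> R.
  rewrite natrX -powR_mulrn ?ler0n // -powRrM mulfV ?powRr1 ?ler0n //.
  by rewrite pnatr_eq0 -lt0n.
by rewrite ge0_ler_powR ?invr_ge0 ?nnegrE ?ler_nat ?ler0n.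
Qed.

Theorem theorem4p2 (R : realType) (m r : nat) (hm : (2 <= m)%N)
    (hr : (3 <= r)%N) :
  exists (c : R) (n1 : nat),
    [/\ 0 < c, (0 < n1)%N &
        forall n : nat, (n1 <= n)%N ->
          (exL n r (fun T => @linear_cycle T r (2 * m)))%:R
            <= c * n%:R `^ (1 + m%:R^-1)].
Proof.
(* The factor 2 comes from bounding [q] by twice the [m]-th root of [n]. *)
exists (degree_bound m r 1 * 2)%:R, 1%N; split=> // n n1.
have m0 : (0 < m)%N by apply: leq_trans hm.
have [q [q1 nq qn]] := exists_nat_root m0 n1.
have exL_le : (exL n r (fun T => @linear_cycle T r (2 * m)) <=
    n * (degree_bound m r 1 * q))%N.
  apply/bigmax_leqP=> H /and3P[unifH linH freeH].
  apply: leq_trans (leq_mul (leqnn n) (degree_bound_le m r (ltnW q1))).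
  rewrite -[n in (n * _)%N]card_ord.
  by apply: card_linear_cycle_free; rewrite ?card_ord // ltnW.
have root_ge1 : 1 <= n%:R `^ m%:R^-1 :> R.
  by apply: (@ler_powR_root R m 1 n); rewrite ?exp1n.
(* Write [q] as [q.-1 + 1]; both summands are at most the root. *)
have q_le : q%:R <= 2%:R * n%:R `^ m%:R^-1 :> R.
  rewrite -(ltn_predK q1) -natr1 mulr_natl mulr2n lerD //.
  exact: ler_powR_root.
apply: (@le_trans _ _ (n * (degree_bound m r 1 * q))%:R); first by rewrite ler_nat.
rewrite powRD; last by rewrite pnatr_eq0 -lt0n n1 implybT.
rewrite powRr1 ?ler0n // !natrM mulrCA -!mulrA ler_wpM2l ?ler0n //.
by rewrite [leRHS]mulrCA ler_wpM2l ?ler0n.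
Qed.
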